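(* The Eulerian polynomials $A_n$ satisfy the following. 1. If $m$ and $n$ are positive integers of different parity and $j\neq k$ are positive integers, then \[ \int_{-\infty}^{0}\frac{A_{2j}(x)^m\,A_{2k}(x)^n}{(1-x)^{2+m(2j-1)+n(2k-1)}}\,dx=0. \] 2. For all integers $j,k\ge1$, \[ \int_{-\infty}^{0}\frac{A_{2j}(x)\,A_{2k-1}(x)}{(1-x)^{2+(2j-1)+(2k-2)}}\,dx=0. \] 3. For every integer $n\ge2$, \[ \int_{-\infty}^{0}\frac{A_n(x)}{(1-x)^{n+1}}\,dx=0. \]
   Context: The Eulerian polynomials $(A_n(x))_{n\ge0}$ are defined by the exponential generating function \[ \sum_{n=0}^{\infty} A_n(x)\,\frac{t^n}{n!}=\frac{1-x}{e^{t(x-1)}-x},\qquad x\neq1 \] (so $A_0=A_1=1$, $A_2(x)=1+x$, $A_3(x)=1+4x+x^2$, and $A_n$ has degree $n-1$ for $n\ge1$). *)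

(* Defs.v *)
From HB Require Import structures.
From mathcomp Require Export all_boot all_order all_algebra.
From mathcomp Require Export all_classical all_reals all_analysis.
From mathcomp Require Import ring lra.
Set Implicit Arguments.
Unset Strict Implicit.
Unset Printing Implicit Defensive.
Import Order.TTheory GRing.Theory Num.Theory.
Import numFieldNormedType.Exports.
Local Open Scope classical_set_scope.
Local Open Scope ring_scope.

(* The neighbourhood of 0 in which the series has the prescribed sum may depend
   on x: its radius of convergence in t does. *)
Definition eulerian_polynomials (R : realType) (A : nat -> {poly R}) : Prop :=
  forall x : R, x != 1 ->
    \forall t \near (0 : R),
      pseries (fun n => (A n).[x] / n`!%:R) t @ \oo
        --> (1 - x) / (expR (t * (x - 1)) - x).

(* The predicate is satisfiable: multiplying the generating function by its
   denominator and comparing coefficients of t^n gives a recursion, whose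
   solution is shown to have the prescribed generating function. *)
Section eulerian_existence.
Variable R : realType.

Fixpoint eulerian_seq (n : nat) : seq {poly R} :=
  if n is n'.+1 then
    rcons (eulerian_seq n')
      (\sum_(k < n'.+1) ('C(n'.+1, k)%:R *: (('X - 1) ^+ (n' - k) * (eulerian_seq n')`_k)))
  else [:: 1].

Lemma size_eulerian_seq n : size (eulerian_seq n) = n.+1.
Proof. by elim: n => //= n IH; rewrite size_rcons IH. Qed.

Definition eulerian n := (eulerian_seq n)`_n.

Lemma eulerian_seqE n k : (k <= n)%N -> (eulerian_seq n)`_k = eulerian k.
Proof.
elim: n => [|n IH]; first by case: k.
rewrite leq_eqVlt => /orP[/eqP->//|kn].
by rewrite /= nth_rcons size_eulerian_seq kn IH.
Qed.

Lemma eulerianS n : eulerian n.+1 =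
  \sum_(k < n.+1) ('C(n.+1, k)%:R *: (('X - 1) ^+ (n - k) * eulerian k)).
Proof.
rewrite /eulerian /= nth_rcons size_eulerian_seq ltnn eqxx.
by apply: eq_bigr => k _; rewrite eulerian_seqE// -ltnS.
Qed.

Variable x : R.
Let a n := (eulerian n).[x] / n`!%:R.
Let y := x - 1.

Lemma egf_coef0 : a 0 = 1.
Proof. by rewrite /a /eulerian /= hornerC fact0 divr1. Qed.

Lemma egf_coefS n : a n.+1 = \sum_(k < n.+1) y ^+ (n - k) / (n.+1 - k)`!%:R * a k.
Proof.
rewrite {1}/a eulerianS horner_sum mulr_suml; apply: eq_bigr => k _.
rewrite hornerZ hornerM horner_exp -polyC1 hornerXsubC /a.
have f0 m : (m`!%:R : R) != 0 by rewrite pnatr_eq0 -lt0n fact_gt0.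
have kn : (k <= n.+1)%N by apply: ltnW.
rewrite -(bin_fact kn) !natrM.
have : 'C(n.+1, k)%:R != 0 :> R by rewrite pnatr_eq0 -lt0n bin_gt0.
move=> b0; rewrite /y; field.
by rewrite b0 !f0.
Qed.

Lemma egf_coef_le n : `|a n| <= (1 + `|y|) ^+ n.
Proof.
elim/ltn_ind: n => -[|n] IH; first by rewrite egf_coef0 normr1 expr0.
rewrite egf_coefS (le_trans (ler_norm_sum _ _ _))//.
apply: (@le_trans _ _ (\sum_(k < n.+1) `|y| ^+ (n - k) * (1 + `|y|) ^+ k)).
  apply: ler_sum => k _; rewrite normrM ler_pM//; last exact: IH.
  rewrite normrM normrX normfV [`|_%:R|]ger0_norm// ler_piMr ?exprn_ge0//.
  by rewrite invf_le1 ?ltr0n ?fact_gt0// ler1n fact_gt0.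
have := subrXX `|y| (1 + `|y|) n.+1; rewrite opprD addrCA subrr addr0 mulN1r.
move=> H; rewrite -[leLHS]opprK -H opprB gerBl exprn_ge0//.
Qed.

Let E m s : R := \sum_(0 <= k < m) s ^+ k / k`!%:R.

Lemma egf_convolution t N : \sum_(0 <= n < N.+1) a n * t ^+ n * (E (N.+1 - n) (t * y) - x) = 1 - x.
Proof.
elim: N => [|N IH].
  by rewrite big_nat1 egf_coef0 /E big_nat1 !expr0 fact0 divr1 !mul1r.
rewrite -[RHS]IH big_nat_recr//= subSnn /E big_nat1 expr0 fact0 divr1.
rewrite [X in X + _](_ : _ = \sum_(0 <= n < N.+1) a n * t ^+ n * (E (N.+1 - n) (t * y) - x) +
  \sum_(0 <= n < N.+1) a n * t ^+ n * ((t * y) ^+ (N.+1 - n) / (N.+1 - n)`!%:R)); last first.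
  rewrite -big_split/=; apply: eq_big_nat => n /andP[_ nN].
  rewrite -mulrDr; congr (_ * _).
  by rewrite /E subSn ?(ltnW nN)// big_nat_recr//=; ring.
rewrite -addrA [X in _ + X](_ : _ = 0) ?addr0//.
rewrite egf_coefS mulr_suml mulr_suml big_mkord -big_split/= big1// => k _.
have kN : (k <= N)%N by rewrite -ltnS.
rewrite exprMn subSn//.
have -> : t ^+ N.+1 = t ^+ k * t ^+ (N - k).+1.
  by rewrite -exprD addnS subnKC.
rewrite !exprS /y.
move: (t ^+ k) (t ^+ (N - k)) ((x-1) ^+ (N - k)) (a k) (((N - k).+1`!)%:R^-1 : R) => u v w b c.
ring.
Qed.

Lemma expR_tail_le s m : `|s| <= 2^-1 -> `|expR s - E m s| <= 2 * `|s| ^+ m.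
Proof.
move=> s2.
have cE : (fun M => `|E M s - E m s|) @ \oo --> `|expR s - E m s|.
  apply: cvg_norm; apply: cvgB; last exact: cvg_cst.
  exact: is_cvg_series_exp_coeff.
rewrite -(cvg_lim _ cE)//; apply: limr_le; first by apply/cvg_ex; eexists; exact: cE.
exists m => //= M /= mM.
rewrite /E (big_cat_nat (leq0n m) mM)//= [X in X - _]addrC addrK.
rewrite (le_trans (ler_norm_sum _ _ _))//.
apply: (@le_trans _ _ (\sum_(m <= k < M) `|s| ^+ k)).
  apply: ler_sum => k _.
  rewrite normrM normrX normfV [`|_%:R|]ger0_norm// ler_piMr ?exprn_ge0//.
  by rewrite invf_le1 ?ltr0n ?fact_gt0// ler1n fact_gt0.
suff : (\sum_(m <= k < M) `|s| ^+ k) <= 2 * (`|s| ^+ m - `|s| ^+ M).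
  move=> /le_trans; apply; rewrite ler_pM2l// gerBl exprn_ge0//.
elim: M mM {cE} => [|M IH].
  by rewrite leqn0 => /eqP->; rewrite big_geq// subrr mulr0.
rewrite leq_eqVlt => /orP[/eqP->|mM]; first by rewrite big_geq// subrr mulr0.
rewrite big_nat_recr//= exprS.
have := IH mM; have : 0 <= `|s| ^+ M by rewrite exprn_ge0.
set p := `|s| ^+ M; nra.
Qed.

Lemma egf_partial_sum_le t N : (1 + `|y|) * `|t| <= 4^-1 ->
  `|(\sum_(0 <= n < N.+1) a n * t ^+ n) * (expR (t * y) - x) - (1 - x)| <= 2 * (2^-1) ^+ N.+1.
Proof.
move=> q4; set q := (1 + `|y|) * `|t| in q4.
have q0 : 0 <= q by rewrite mulr_ge0// addr_ge0.
have sq : `|t * y| <= q.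
  by rewrite normrM mulrC /q mulrDl mul1r lerDr.
rewrite -(egf_convolution t N) mulr_suml -sumrB.
rewrite (le_trans (ler_norm_sum _ _ _))//.
apply: (@le_trans _ _ (\sum_(0 <= n < N.+1) 2 * q ^+ N.+1)).
  apply: ler_sum_nat => n /andP[_ nN].
  rewrite -mulrBr opprB addrA subrK normrM.
  have -> : 2 * q ^+ N.+1 = q ^+ n * (2 * q ^+ (N.+1 - n)).
    by rewrite mulrCA -exprD subnKC// ltnW.
  apply: ler_pM => //.
    by rewrite normrM normrX /q exprMn ler_wpM2r ?exprn_ge0// egf_coef_le.
  apply: le_trans (expR_tail_le _ _) _; first by lra.
  by rewrite ler_pM2l// lerXn2r// nnegrE.
rewrite sumr_const_nat subn0 -mulrnAr ler_pM2l// -mulr_natr.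
apply: (@le_trans _ _ ((4^-1) ^+ N.+1 * 2 ^+ N.+1)).
  apply: ler_pM => //; first by rewrite exprn_ge0.
    by rewrite lerXn2r// nnegrE// invr_ge0.
  by rewrite -natrX ler_nat ltnW// ltn_expl.
rewrite -exprMn (_ : 4^-1 * 2 = 2^-1 :> R) //; by field.
Qed.

Lemma egf_cvg (xn1 : x != 1) : \forall t \near (0 : R),
      pseries a t @ \oo --> (1 - x) / (expR (t * (x - 1)) - x).
Proof.
near=> t.
have D0 : expR (t * y) - x != 0.
  near: t.
  have : (fun t => expR (t * y) - x) @ (0 : R) --> expR (0 * y) - x.
    apply: cvgB; last exact: cvg_cst.
    apply: continuous_cvg; first exact: continuous_expR.
    by apply: cvgM; [exact: cvg_id|exact: cvg_cst].
  rewrite mul0r expR0 => H.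
  have : 1 - x != 0 by rewrite subr_eq0 eq_sym.
  by move=> /(cvgr_neq0 _ H).
have qt : (1 + `|y|) * `|t| <= 4^-1.
  near: t.
  have y0 : 0 < 1 + `|y| by rewrite ltr_pwDl.
  have e0 : 0 < 4^-1 / (1 + `|y|) by rewrite divr_gt0// invr_gt0.
  have H : \forall u \near (0 : R), `|u| <= 4^-1 / (1 + `|y|) by exact: (@nbhs0_le _ R).
  by apply: filterS H => u; rewrite ler_pdivlMr// mulrC.
have H : (fun N => pseries a t N * (expR (t * y) - x)) @ \oo --> 1 - x.
  rewrite -cvg_shiftS /=.
  apply/subr_cvg0; apply/norm_cvg0P.
  apply: (@squeeze_cvgr _ _ _ _ (fun=> 0) (fun N => 2 * (2^-1) ^+ N.+1)).
  - near=> N; rewrite normr_ge0/=; exact: egf_partial_sum_le.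
  - exact: cvg_cst.
  rewrite -[X in _ --> X](mulr0 2).
  apply: cvgMr; rewrite (cvg_shiftS (fun N => (2^-1) ^+ N : R)).
  by apply: cvg_expr; rewrite ger0_norm ?invr_ge0// invf_lt1// ltr1n.
rewrite (_ : pseries a t = (fun N => pseries a t N * (expR (t * y) - x) / (expR (t * y) - x))).
  by apply: cvgMl.
by apply/funext => N; rewrite mulfK.
Unshelve. all: by end_near. Qed.
End eulerian_existence.

Lemma eulerian_polynomials_exist (R : realType) :
  exists A : nat -> {poly R}, eulerian_polynomials A.
Proof. by exists (@eulerian R) => x xn1; exact: egf_cvg. Qed.

(* Main.v *)
(* The substitution s = 1 / (1 - x) maps ]-oo, 0] onto ]0, 1] and turns
   A_(n+1)(x) / (1 - x)^n into a polynomial Q_n(s) with Q_0 = 1 and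
   Q_(n+1) = (s (s - 1) Q_n)'.  Hence Q_n(1 - s) = (-1)^n Q_n(s), and all three
   integrals become integrals over [0, 1] of polynomials in s: the first two are
   antisymmetric under s |-> 1 - s, the third is Q_(n+1), whose antiderivative
   s (s - 1) Q_n vanishes at both ends. *)
From HB Require Import structures.
Require Import Defs.
From mathcomp Require Import measurable_realfun ring lra.
Import Order.TTheory GRing.Theory Num.Theory.
Import numFieldNormedType.Exports.
Local Open Scope classical_set_scope.
Local Open Scope ring_scope.
Set Implicit Arguments.
Unset Strict Implicit.
Unset Printing Implicit Defensive.

(** * Uniqueness of the coefficients of a power series *)

Lemma pseries_cvg0_coef0 (R : realType) (c : nat -> R) :
  (\forall t \near (0 : R)^', pseries c t @ \oo --> (0 : R)) -> c 0%N = 0.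
Proof.
move=> c0.
have [r [r0 cr]] : exists r : R, 0 < r /\ pseries c r @ \oo --> (0 : R).
  move: c0; rewrite near_withinE => /nbhs_ballP[e /= e0 He].
  exists (e / 2); split; first by rewrite divr_gt0.
  apply: He; last by rewrite gt_eqF// divr_gt0.
  rewrite /ball/= sub0r normrN gtr0_norm ?divr_gt0//.
  by rewrite ltr_pdivrMr// ltr_pMr// ltr1n.
have [M M0 HM] : exists2 M : R, 0 <= M & forall n, `|c n * r ^+ n| <= M.
  have : bounded_fun (fun n => c n * r ^+ n).
    by apply: cvg_series_bounded; apply/cvg_ex; exists 0; exact: cr.
  move=> [N [_ HN]]; exists (`|N| + 1); first by rewrite addr_ge0.
  by move=> n; apply: HN => //; rewrite ltr_pwDr// ler_norm.
(* The terms at [r] are bounded by [M], so for t <= r / 2 the series without its constant term is at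
   most M (q + q^2 + ...) <= 2 M q, where q = t / r. Since the sum is 0, this bounds |c 0| by a
   multiple of t, and t may tend to 0. *)
have tail (t : R) : 0 < t -> t <= r / 2 -> pseries c t @ \oo --> (0 : R) ->
    `|c 0%N| <= 2 * M / r * t.
  move=> t0 tr ct.
  pose q := t / r.
  have q0 : 0 <= q by rewrite divr_ge0 ?ltW.
  have q2 : q <= 2^-1 by rewrite /q ler_pdivrMr// mulrC.
  have part n : `|pseries c t n.+1 - c 0%N| <= 2 * M / r * t.
    rewrite /pseries/series/= big_nat_recl// expr0 mulr1 addrAC subrr add0r.
    rewrite (le_trans (ler_norm_sum _ _ _))//.
    have -> : 2 * M / r * t = M * (2 * q) by rewrite /q; ring.
    (* Subtracting [q ^+ n.+1] makes the bound inductive: as q <= 1/2, each increment absorbs the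
       new term. *)
    apply: (@le_trans _ _ (M * (2 * (q - q ^+ n.+1)))); last first.
      by rewrite ler_wpM2l// ler_pM2l// gerBl exprn_ge0.
    elim: n => [|n IH]; first by rewrite big_geq// expr1 subrr !mulr0.
    rewrite big_nat_recr//=.
    have -> : c n.+1 * t ^+ n.+1 = c n.+1 * r ^+ n.+1 * q ^+ n.+1.
      by rewrite /q expr_div_n mulrA mulrAC mulfK// expf_neq0// gt_eqF.
    rewrite normrM [`|q ^+ _|]ger0_norm ?exprn_ge0//.
    apply: le_trans (lerD IH (ler_wpM2r _ (HM n.+1))) _.
      by rewrite exprn_ge0.
    rewrite -mulrDr ler_wpM2l// [in X in _ <= X]exprS.
    have : 0 <= q ^+ n.+1 by rewrite exprn_ge0.
    by move: (q ^+ n.+1) => p p0; nra.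
  have cN : (fun n => `|pseries c t n.+1 - c 0%N|) @ \oo --> `|0 - c 0%N|.
    apply: cvg_norm; apply: cvgB; last exact: cvg_cst.
    by rewrite (cvg_shiftS (pseries c t)).
  rewrite -normrN -sub0r -(cvg_lim _ cN)//.
  by apply: limr_le; [apply/cvg_ex; eexists; exact: cN|exact: nearW].
apply/eqP; rewrite -normr_le0; apply/ler_addgt0Pl => e e0; rewrite addr0.
have K0 : 0 < 2 * M / r + 1 by rewrite ltr_wpDl// divr_ge0 ?mulr_ge0// ltW.
near (0 : R)^'+ => t.
have t0 : 0 < t by near: t; exact: nbhs_right_gt.
have tr : t <= r / 2 by near: t; apply: nbhs_right_le; rewrite divr_gt0.
have ct : pseries c t @ \oo --> (0 : R).
  near: t; move: c0; rewrite !near_withinE; apply: filterS => t + t0; apply.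
  by rewrite gt_eqF.
apply: le_trans (tail t t0 tr ct) _.
have : t <= e / (2 * M / r + 1).
  by near: t; apply: nbhs_right_le; rewrite divr_gt0.
rewrite ler_pdivlMr// mulrDr mulr1 => te.
by apply: le_trans te; rewrite mulrC lerDl ltW.
Unshelve. all: by end_near. Qed.

(** Once the constant term is known to vanish, dividing by t gives the shifted series, again with
    sum 0. The neighbourhood is punctured to permit this division. *)
Lemma pseries_cvg0_coef (R : realType) (c : nat -> R) :
  (\forall t \near (0 : R)^', pseries c t @ \oo --> (0 : R)) ->
  forall n, c n = 0.
Proof.
move=> c0 n; elim: n c c0 => [|n IH] c c0; first exact: pseries_cvg0_coef0.
apply: (IH (fun n => c n.+1)); have c00 := pseries_cvg0_coef0 c0.
near=> t.
have t0 : t != 0 by near: t; exact: nbhs_dnbhs_neq.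
have ct : pseries c t @ \oo --> (0 : R) by near: t.
have -> : pseries (fun n => c n.+1) t = (fun n => pseries c t n.+1 * t^-1).
  apply/funext => m; rewrite /pseries/series/= big_nat_recl// c00 mul0r add0r.
  rewrite mulr_suml; apply: eq_bigr => i _.
  by rewrite exprSr mulrA mulfK.
rewrite -(mul0r t^-1); apply: cvgM; last exact: cvg_cst.
by rewrite (cvg_shiftS (pseries c t)).
Unshelve. all: by end_near. Qed.

(** At a fixed x both families have the same generating function near t = 0, so the difference of
    their coefficients has a null power series. *)
Lemma eulerian_polynomials_horner (R : realType) (A : nat -> {poly R}) n x :
  eulerian_polynomials A -> x != 1 -> (A n).[x] = (eulerian R n).[x].
Proof.
move=> hA x1.
pose a n := (A n).[x] / n`!%:R; pose b n := (eulerian R n).[x] / n`!%:R.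
have : \forall t \near (0 : R)^',
    pseries (fun n => a n - b n) t @ \oo --> (0 : R).
  apply: nbhs_dnbhs.
  have h1 := hA _ x1; have h2 := egf_cvg x1.
  near=> t.
  have -> : pseries (fun n => a n - b n) t =
      (fun n => pseries a t n - pseries b t n).
    apply/funext => m; rewrite /pseries/series/= -sumrB.
    by apply: eq_bigr => i _; rewrite mulrBl.
  rewrite -(subrr ((1 - x) / (expR (t * (x - 1)) - x))).
  by apply: cvgB; [near: t; exact: h1|near: t; exact: h2].
move/pseries_cvg0_coef => /(_ n) /eqP; rewrite subr_eq0 => /eqP.
by apply: divIf; rewrite pnatr_eq0 -lt0n fact_gt0.
Unshelve. all: by end_near. Qed.

(** * A_n(x) / (1 - x)^n as a polynomial in s = 1 / (1 - x) *)

Lemma sum_binS (V : nmodType) (F : nat -> V) n :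
  \sum_(k < n.+2) F k *+ 'C(n.+1, k) =
  \sum_(k < n.+1) (F k + F k.+1) *+ 'C(n, k).
Proof.
rewrite big_ord_recl bin0.
under eq_bigr do rewrite binS mulrnDr.
under [RHS]eq_bigr do rewrite mulrnDl.
rewrite !big_split/= addrA; congr (_ + _).
by rewrite [RHS]big_ord_recl bin0 big_ord_recr/= bin_small// mulr0n addr0.
Qed.

Section eulerian_onemV.
Variable R : realType.

(** This is the recurrence A_(n+1) = (1 + n x) A_n + x (1 - x) A_n', written for A_n / (1 - x)^n in
    the variable s. *)
Definition eulerian_op (p : {poly R}) : {poly R} := 'X * (('X - 1) * p)^`().

(** The polynomials Q_n of the overview. *)
Fixpoint eulerian_onemV (n : nat) : {poly R} :=
  if n is n'.+1 then ('X * ('X - 1) * eulerian_onemV n')^`() else 1.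

Lemma derivX_sub1 : ('X - 1 : {poly R})^`() = 1.
Proof. by rewrite derivB derivX -polyC1 derivC subr0. Qed.

Lemma eulerian_op_is_linear : linear eulerian_op.
Proof.
move=> a p q; rewrite /eulerian_op mulrDr derivD -scalerAr derivZ mulrDr.
by rewrite -scalerAr.
Qed.

HB.instance Definition _ := GRing.isLinear.Build R {poly R} {poly R} _
  eulerian_op eulerian_op_is_linear.

Lemma iter_eulerian_op n :
  iter n.+1 eulerian_op 1 = 'X * eulerian_onemV n.
Proof.
elim: n => [|n IH].
  by rewrite /= /eulerian_op !mulr1 derivX_sub1 mulr1.
by rewrite iterS IH {1}/eulerian_op [eulerian_onemV n.+1]/= mulrA
  (mulrC ('X - 1)).
Qed.

(** Binomial expansion of the n-th power of L - id, with L = [eulerian_op], by linearity of L and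
    Pascal's rule. *)
Lemma iter_eulerian_op_sub1 n :
  iter n (fun p => eulerian_op p - p) 1 =
  \sum_(k < n.+1) ((-1) ^+ (n - k) * iter k eulerian_op 1) *+ 'C(n, k).
Proof.
elim: n => [|n IH]; first by rewrite big_ord_recl big_ord0 addr0 /= expr0 mul1r.
rewrite (sum_binS (fun k => (-1) ^+ (n.+1 - k) * iter k eulerian_op 1)).
rewrite iterS IH linear_sum -sumrB; apply: eq_bigr => k _.
rewrite linearMn -mulrnBl; congr (_ *+ _).
have kn : (k <= n)%N by rewrite -ltnS.
rewrite subSS subSn// exprS mulN1r mulNr addrC; congr (_ + _).
by rewrite -signr_odd; case: odd; rewrite ?expr0 ?expr1 ?mul1r ?mulN1r ?linearN.
Qed.

(* Writing [L] for [eulerian_op],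
   [L ('X / ('X - 1) * f) = 'X / ('X - 1) * (L f - f)]. *)
Lemma iter_eulerian_op_intertwine n :
  'X * iter n.+1 (fun p => eulerian_op p - p) 1 =
  ('X - 1) * iter n.+1 eulerian_op 1.
Proof.
elim: n => [|n IH].
  by rewrite /= /eulerian_op mulr1 derivX_sub1 mulr1 mulrC.
rewrite iterS [in RHS]iterS.
set f := iter n.+1 _ 1 in IH *; set g := iter n.+1 _ 1 in IH *.
rewrite /eulerian_op -IH.
by rewrite derivM derivX_sub1 derivM derivX; ring.
Qed.

(** Expand the left side of the intertwining identity binomially: its top term cancels against 'X
    times the iterate on the right. What remains is the recursion [eulerianS] in the variable s. *)
Lemma iter_eulerian_opS n :
  iter n.+1 eulerian_op 1 =
  'X * \sum_(k < n.+1) ((-1) ^+ (n - k) * iter k eulerian_op 1) *+ 'C(n.+1, k).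
Proof.
have := iter_eulerian_op_intertwine n.
rewrite iter_eulerian_op_sub1 big_ord_recr/= subnn expr0 mul1r binn mulr1n.
have -> : \sum_(i < n.+1) ((-1) ^+ (n.+1 - i) * iter i eulerian_op 1)
    *+ 'C(n.+1, i)
  = - \sum_(k < n.+1) ((-1) ^+ (n - k) * iter k eulerian_op 1) *+ 'C(n.+1, k).
  rewrite -sumrN; apply: eq_bigr => i _.
  have kn : (i <= n)%N by rewrite -ltnS.
  by rewrite subSn// exprS mulN1r mulNr mulNrn.
set S := \sum_(_ < _) _; set p := eulerian_op _ => e.
have : 'X * (- S + p) = 'X * p - p by rewrite e mulrBl mul1r.
by rewrite mulrDr mulrN addrC => /addrI /oppr_inj ->.
Qed.

(** Both sides obey the same binomial recursion: x - 1 = -(1 - x) accounts for the signs, and the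
    leading 'X, evaluated at s, cancels one factor 1 - x. *)
Lemma eulerian_horner_op n (x : R) : x != 1 ->
  (eulerian R n).[x] = (1 - x) ^+ n * (iter n eulerian_op 1).[(1 - x)^-1].
Proof.
move=> x1; have x0 : 1 - x != 0 by rewrite subr_eq0 eq_sym.
elim/ltn_ind: n => -[_|n IH].
  by rewrite /eulerian/= expr0 mul1r -polyC1 !hornerC.
rewrite iter_eulerian_opS eulerianS hornerM hornerX mulrA exprSr mulfK//.
rewrite !horner_sum mulr_sumr; apply: eq_bigr => k _.
have X1E m : (('X - 1) ^+ m).[x] = (x - 1) ^+ m.
  by rewrite horner_exp -polyC1 hornerXsubC.
have N1E m s : ((-1 : {poly R}) ^+ m).[s] = (-1) ^+ m.
  by rewrite horner_exp -polyC1 hornerN hornerC.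
rewrite hornerZ hornerM IH// hornerMn hornerM X1E N1E -mulr_natl.
have -> : (1 - x) ^+ n = (1 - x) ^+ (n - k) * (1 - x) ^+ k.
  by rewrite -exprD subnK// -ltnS.
have -> : (x - 1) ^+ (n - k) = (-1) ^+ (n - k) * (1 - x) ^+ (n - k).
  by rewrite -exprMn mulN1r opprB.
ring.
Qed.

Lemma eulerian_hornerS n (x : R) : x != 1 ->
  (eulerian R n.+1).[x] = (1 - x) ^+ n * (eulerian_onemV n).[(1 - x)^-1].
Proof.
move=> x1; have x0 : 1 - x != 0 by rewrite subr_eq0 eq_sym.
by rewrite eulerian_horner_op// iter_eulerian_op hornerM hornerX mulrA
  exprSr mulfK.
Qed.

(** The factor X (X - 1) is invariant under X |-> 1 - X, and each differentiation contributes one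
    sign. *)
Lemma eulerian_onemV_comp n :
  eulerian_onemV n \Po (1 - 'X) = (-1) ^+ n *: eulerian_onemV n.
Proof.
elim: n => [|n IH]; first by rewrite /= -polyC1 comp_polyC expr0 scale1r.
have d : (1 - 'X : {poly R})^`() = - 1.
  by rewrite derivB derivX -polyC1 derivC sub0r.
have /= := deriv_comp ('X * ('X - 1) * eulerian_onemV n) (1 - 'X).
rewrite d mulrN1 => /eqP; rewrite -eqr_oppLR => /eqP <-.
have cX1 : ('X - 1 : {poly R}) \Po (1 - 'X) = - 'X.
  by rewrite comp_polyB comp_polyX -polyC1 comp_polyC addrAC subrr add0r.
rewrite !comp_polyM cX1 comp_polyX IH.
rewrite -derivN exprS mulN1r scaleNr -scalerN -derivN -derivZ; congr (_^`()).
by rewrite -!scalerAr -scalerN; congr (_ *: _); ring.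
Qed.
End eulerian_onemV.

(** * Integration over ]-oo, 0] of polynomials in s *)

Lemma poly_antiderivative (R : numFieldType) (p : {poly R}) :
  exists q : {poly R}, q^`() = p.
Proof.
(* At i = 0 the coefficient is a division by 0, hence 0: the constant term is free. *)
exists (\poly_(i < (size p).+1) (p`_i.-1 / i%:R)).
apply/polyP => i; rewrite coef_deriv coef_poly ltnS.
case: ltnP => [_|pi]; last by rewrite mul0rn nth_default.
by rewrite -[LHS]mulr_natr divfK// pnatr_eq0.
Qed.

Lemma continuous_horner_onemV (R : realType) (p : {poly R}) (x : R) :
  x <= 0 -> {for x, continuous (fun x : R => p.[(1 - x)^-1] / (1 - x) ^+ 2)}.
Proof.
move=> x0; have n0 : 1 - x != 0 by apply/eqP; lra.
have cV : {for x, continuous (fun x : R => (1 - x)^-1)}.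
  by apply: cvgV => //; apply: cvgB; [exact: cvg_cst|exact: cvg_id].
have -> : (fun x : R => p.[(1 - x)^-1] / (1 - x) ^+ 2) =
    (fun x => p.[(1 - x)^-1] * ((1 - x)^-1 * (1 - x)^-1)).
  by apply/funext => y; rewrite -exprVn expr2.
apply: cvgM; first by apply: continuous_comp cV _; exact: continuous_horner.
exact: cvgM.
Qed.

(** Since ds = dx / (1 - x)^2, the integrand is the derivative of W(s), with s running from 0 to 1.
    The sign condition gives access to the fundamental theorem of calculus on a half-line without
    prior integrability. *)
Lemma ge0_integral_deriv_onemV (R : realType) (W : {poly R}) :
  (forall s, 0 <= s -> s <= 1 -> 0 <= W^`().[s]) ->
  (\int[@lebesgue_measure R]_(x in `]-oo, 0%R])
     (W^`().[(1 - x)^-1] / (1 - x) ^+ 2)%:E = (W.[1] - W.[0])%:E)%E.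
Proof.
move=> W0.
have add_ne0 (x : R) : 0 <= x -> 1 + x != 0 by move=> x0; apply/eqP; lra.
pose f (x : R) : R := W^`().[(1 - x)^-1] / (1 - x) ^+ 2.
have cf := @continuous_horner_onemV R W^`().
have f0 (x : R) : x <= 0 -> 0 <= f x.
  move=> x0; rewrite divr_ge0 ?sqr_ge0// W0 ?invr_ge0//; first by lra.
  by rewrite invf_le1; lra.
have dF (x : R) : 0 <= x ->
    is_derive x (1 : R) (fun x : R => - W.[(1 + x)^-1]) (f (- x)).
  move=> x0.
  have dV : is_derive x (1 : R) (fun x : R => (1 + x)^-1) (- (1 + x) ^- 2 *: 1).
    apply: is_deriveV; first exact: add_ne0.
    by apply: is_derive_eq; rewrite add0r.
  have := is_deriveN (is_derive1_comp (is_derive_poly W _) dV).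
  by move/is_derive_eq; apply; rewrite /f opprK scaler1 mulrN opprK.
(* The reflection x |-> -x moves the integral to [0, +oo[, where [- W.[(1 + x)^-1]] is an
   antiderivative tending to [- W.[0]]. *)
have := @ge0_integration_by_substitutionNy R f 0.
rewrite oppr0 => ->; last 2 first.
- apply/continuous_within_itvNycP; split.
    by move=> x; rewrite in_itv/= => /ltW /cf.
  by apply: cvg_at_left_filter; exact: cf.
- by move=> x; rewrite in_itv/= => /ltW /f0.
rewrite (@ge0_continuous_FTC2y R _ (fun x => - W.[(1 + x)^-1]) _ (- W.[0])).
- by rewrite addr0 invr1 -EFinB opprK addrC.
- by move=> x x0; apply: f0; rewrite oppr_le0.
- have cfN (x : R) : 0 <= x -> {for x, continuous (f \o -%R)}.
    move=> x0; apply: continuous_comp; first exact: opp_continuous.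
    by apply: cf; rewrite oppr_le0.
  apply/continuous_within_itvcyP; split.
    by move=> x; rewrite in_itv/= andbT => /ltW /cfN.
  by apply: cvg_at_right_filter; exact: cfN.
- apply: cvgN; apply: continuous_cvg; first exact: continuous_horner.
  apply/gtr0_cvgV0; last exact: cvg_addrl.
  by exists 0; split => // x x0; rewrite addr_gt0.
- by move=> x /ltW /dF [].
- apply: cvg_at_right_filter.
  by have [/derivable1_diffP/differentiable_continuous + _] := dF 0 (lexx 0).
- move=> x; rewrite in_itv/= andbT => /ltW /dF [_ e].
  by rewrite derive1E e.
Qed.

(** Powers of s are at most 1 on [0, 1]. This supplies the constant that shifts a polynomial to a
    nonnegative one. *)
Lemma horner_ge_sum_normN (R : realDomainType) (p : {poly R}) (s : R) :
  0 <= s -> s <= 1 -> - \sum_(i < size p) `|p`_i| <= p.[s].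
Proof.
move=> s0 s1; rewrite horner_coef -sumrN; apply: ler_sum => i _.
apply: lerNnormlW; rewrite normrM ler_piMr// ger0_norm ?exprn_ge0//.
by rewrite exprn_ile1.
Qed.

(** The integrand equals its absolute value, whose integral is the finite number just computed. *)
Lemma ge0_integrable_deriv_onemV (R : realType) (V : {poly R}) :
  (forall s, 0 <= s -> s <= 1 -> 0 <= V^`().[s]) ->
  (@lebesgue_measure R).-integrable `]-oo, 0%R]
    (EFin \o (fun x => V^`().[(1 - x)^-1] / (1 - x) ^+ 2)).
Proof.
move=> V0; apply/integrableP; split.
  apply/measurable_EFinP; apply: subspace_continuous_measurable_fun => //.
  apply/continuous_within_itvNycP; split.
    by move=> x; rewrite in_itv/= => /ltW x0; exact: continuous_horner_onemV.
  by apply: cvg_at_left_filter; exact: continuous_horner_onemV.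
rewrite [ltLHS](_ : _ = (V.[1] - V.[0])%:E) ?ltry//.
rewrite -ge0_integral_deriv_onemV//; apply: eq_integral => x xI.
have x0 : x <= 0 by move: xI; rewrite inE/= in_itv.
rewrite [LHS]gee0_abs// lee_fin divr_ge0 ?sqr_ge0//.
by rewrite V0 ?invr_ge0; [|lra|rewrite invf_le1; lra].
Qed.

Lemma integral_deriv_onemV (R : realType) (W : {poly R}) :
  (\int[@lebesgue_measure R]_(x in `]-oo, 0%R])
     (W^`().[(1 - x)^-1] / (1 - x) ^+ 2)%:E = (W.[1] - W.[0])%:E)%E.
Proof.
(* Adding [C *: 'X] to [W] makes the integrand nonnegative. *)
pose C : R := \sum_(i < size W^`()) `|W^`()`_i|.
have dX : (C *: 'X)^`() = C%:P :> {poly R} by rewrite derivZ derivX alg_polyC.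
have W0 s : 0 <= s -> s <= 1 -> 0 <= (W + C *: 'X)^`().[s].
  move=> s0 s1; rewrite derivD dX !hornerE -lerBlDr sub0r.
  exact: horner_ge_sum_normN.
have X0 s : 0 <= s -> s <= 1 -> 0 <= (C *: 'X)^`().[s].
  by move=> _ _; rewrite dX hornerC sumr_ge0.
have mD : measurable (`]-oo, 0%R] : set (measurableTypeR R)) by [].
(* Both shifted integrands are nonnegative, hence integrable, so the integral of their difference
   splits and [C] cancels. *)
have := integralB_EFin mD (ge0_integrable_deriv_onemV W0)
  (ge0_integrable_deriv_onemV X0).
rewrite (ge0_integral_deriv_onemV W0) (ge0_integral_deriv_onemV X0).
rewrite !hornerE -EFinB.
have -> : W.[1] + C - W.[0] - (C - 0) = W.[1] - W.[0] by ring.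
move=> <-; apply: eq_integral => x _.
by rewrite -EFinB -mulrBl derivD hornerD addrK.
Qed.

Lemma comp_poly_exp (R : comNzRingType) (p q : {poly R}) n :
  (p ^+ n) \Po q = (p \Po q) ^+ n.
Proof. exact: (rmorphXn (comp_poly q)). Qed.

(** Averaging an antiderivative of p with its reflection gives another antiderivative, by
    antisymmetry of p, and this one takes equal values at 0 and 1. *)
Lemma integral_onemV_antisym (R : realType) (p : {poly R}) :
  p \Po (1 - 'X) = - p ->
  (\int[@lebesgue_measure R]_(x in `]-oo, 0%R])
     (p.[(1 - x)^-1] / (1 - x) ^+ 2)%:E = 0)%E.
Proof.
move=> pN; have [q qp] := poly_antiderivative p.
pose W := 2^-1 *: (q + (q \Po (1 - 'X))).
have <- : W^`() = p.
  rewrite /W derivZ derivD deriv_comp qp pN derivB derivX -polyC1 derivC.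
  rewrite sub0r mulrN1 opprK -mulr2n -[p *+ 2]scaler_nat scalerA.
  by rewrite mulVf ?scale1r.
rewrite integral_deriv_onemV /W !hornerE !horner_comp !hornerE subrr subr0.
by rewrite [X in _ - _ * X]addrC subrr.
Qed.

(** * The three families of integrals *)

Theorem lemma5 (R : realType) (A : nat -> {poly R})
    (hA : eulerian_polynomials A) :
  [/\ forall m n j k : nat,
        (0 < m)%N -> (0 < n)%N -> odd m != odd n ->
        (0 < j)%N -> (0 < k)%N -> j != k ->
        (\int[@lebesgue_measure R]_(x in `]-oo, 0%R])
           (((A (2 * j)%N).[x] ^+ m * (A (2 * k)%N).[x] ^+ n) /
            (1 - x) ^+ (2 + m * (2 * j - 1) + n * (2 * k - 1))%N)%:E = 0)%E,
      forall j k : nat, (1 <= j)%N -> (1 <= k)%N ->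
        (\int[@lebesgue_measure R]_(x in `]-oo, 0%R])
           (((A (2 * j)%N).[x] * (A (2 * k - 1)%N).[x]) /
            (1 - x) ^+ (2 + (2 * j - 1) + (2 * k - 2))%N)%:E = 0)%E
    & forall n : nat, (2 <= n)%N ->
        (\int[@lebesgue_measure R]_(x in `]-oo, 0%R])
           ((A n).[x] / (1 - x) ^+ (n + 1)%N)%:E = 0)%E].
Proof.
have A_onemV n (x : R) : (0 < n)%N -> x <= 0 -> 1 - x != 0 /\
    (A n).[x] = (1 - x) ^+ (n - 1) * (eulerian_onemV R (n - 1)).[(1 - x)^-1].
  case: n => // n _ x0; have x1 : x != 1 by apply/eqP; lra.
  rewrite subn1 (eulerian_polynomials_horner _ hA x1) eulerian_hornerS//.
  by rewrite subr_eq0 eq_sym.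
have odd_double_sub1 j : (0 < j)%N -> odd (2 * j - 1).
  by move=> j0; rewrite oddB ?muln_gt0// oddM.
split.
- move=> m n j k m0 n0 mn j0 k0 _.
  have j20 : (0 < 2 * j)%N by rewrite muln_gt0.
  have k20 : (0 < 2 * k)%N by rewrite muln_gt0.
  (* Both indices are odd, so each factor changes sign under s |-> 1 - s; the total sign is (-1)^(m
     + n) = -1 because m and n have different parity. *)
  rewrite -[RHS](@integral_onemV_antisym R (eulerian_onemV R (2 * j - 1) ^+ m *
    eulerian_onemV R (2 * k - 1) ^+ n)); last first.
    rewrite comp_polyM !comp_poly_exp !eulerian_onemV_comp.
    rewrite -(signr_odd _ (2 * j - 1)) -(signr_odd _ (2 * k - 1)).
    rewrite !odd_double_sub1// expr1 !scaleN1r.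
    rewrite (exprNn _ m) (exprNn _ n) mulrACA -exprD -signr_odd oddD.
    by case: (odd m) (odd n) mn => -[]//= _; rewrite expr1 mulN1r.
  apply: eq_integral => x; rewrite inE/= in_itv/= => x0; congr EFin.
  have [n1 ->] := A_onemV _ x j20 x0; have [_ ->] := A_onemV _ x k20 x0.
  rewrite hornerM !horner_exp !exprMn -!exprM !exprD.
  rewrite ![((2 * _ - 1) * _)%N]mulnC; field.
  by rewrite n1 !expf_neq0.
- move=> j k j0 k0.
  have j20 : (0 < 2 * j)%N by rewrite muln_gt0.
  have k20 : (0 < 2 * k - 1)%N by rewrite odd_gt0// odd_double_sub1.
  (* Here one index is odd and the other even, so exactly one factor changes sign. *)
  rewrite -[RHS](@integral_onemV_antisym R (eulerian_onemV R (2 * j - 1) *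
    eulerian_onemV R (2 * k - 1 - 1))); last first.
    rewrite comp_polyM !eulerian_onemV_comp.
    rewrite -(signr_odd _ (2 * j - 1)) -(signr_odd _ (2 * k - 1 - 1)).
    by rewrite (oddB k20) !odd_double_sub1// expr0 expr1 scale1r scaleN1r mulNr.
  apply: eq_integral => x; rewrite inE/= in_itv/= => x0; congr EFin.
  have [n1 ->] := A_onemV _ x j20 x0; have [_ ->] := A_onemV _ x k20 x0.
  (* Aligns the exponent 2k - 2 with the index 2k - 1 - 1 that comes from A_(2k-1). *)
  rewrite -[(2 * k - 2)%N]/(2 * k - (1 + 1))%N subnDA hornerM !exprD; field.
  by rewrite n1 !expf_neq0.
move=> [|[|n]]// _.
(* With n + 2 for the original index, the integrand is Q_(n+1)(s) / (1 - x)^2, and Q_(n+1) is by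
   definition the derivative of [W]. *)
pose W := 'X * ('X - 1) * eulerian_onemV R n.
have := integral_deriv_onemV W.
rewrite /W !hornerM !hornerX -polyC1 hornerXsubC subrr !(mulr0, mul0r) subrr.
move=> intW; rewrite -[RHS]intW; apply: eq_integral => x.
rewrite inE/= in_itv/= => x0; congr EFin.
have [n1 ->] := A_onemV n.+2 x isT x0.
rewrite subn1 addn1 -[n.+3]addn2 exprD polyC1 [eulerian_onemV _ _]/=; field.
by rewrite n1 expf_neq0.
Qed.
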